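(* Let $X$ be a topological space, $Y$ an $e^*\theta$-normal topological space, and $f:X\to Y$ an injection that is strongly $e^*$-irresolute and closed (images of closed sets are closed). Then $X$ is $e^*\theta$-normal.
   Context: For a subset $A$ of a topological space $X$, $cl(A)$ and $int(A)$ denote closure and interior. The $\delta$-closure $cl_\delta(A)$ is the set of points $x\in X$ such that $int(cl(U))\cap A\neq\emptyset$ for every open $U$ containing $x$. $A$ is $e^*$-open if $A\subseteq cl(int(cl_\delta(A)))$; complements of $e^*$-open sets are $e^*$-closed; $e^*\text{-}cl(A)$ is the intersection of all $e^*$-closed sets containing $A$. The $e^*$-$\theta$-closure $e^*\text{-}cl_\theta(A)$ is the set of points $x\in X$ such that $e^*\text{-}cl(U)\cap A\neq\emptyset$ for every $e^*$-open set $U$ containing $x$. $A$ is $e^*$-$\theta$-closed if $A=e^*\text{-}cl_\theta(A)$; complements of $e^*$-$\theta$-closed sets are called $e^*$-$\theta$-open. A function $f:X\to Y$ is strongly $e^*$-irresolute if for each $x\in X$ and each $e^*$-open set $V$ of $Y$ containing $f(x)$ there exists an $e^*$-open set $U$ of $X$ containing $x$ such that $f[e^*\text{-}cl(U)]\subseteq V$. A space is $e^*\theta$-normal if for any pair of disjoint closed sets $F_1$ and $F_2$ there exist disjoint $e^*$-$\theta$-open sets $U_1$ and $U_2$ with $F_1\subseteq U_1$ and $F_2\subseteq U_2$. *)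

(* Defs.v *)
From mathcomp Require Import all_boot all_classical topology.

Set Implicit Arguments.
Unset Strict Implicit.
Unset Printing Implicit Defensive.

Local Open Scope classical_set_scope.

Definition delta_closure (T : topologicalType) (A : set T) : set T :=
  [set x | forall U : set T, open U -> U x ->
    interior (closure U) `&` A !=set0].

Definition estar_open (T : topologicalType) (A : set T) : Prop :=
  A `<=` closure (interior (delta_closure A)).

Definition estar_closed (T : topologicalType) (A : set T) : Prop :=
  estar_open (~` A).

(* [smallest C A] is by definition the intersection of all the sets satisfying
   [C] and containing [A]. *)
Definition estar_closure (T : topologicalType) (A : set T) : set T :=
  smallest (@estar_closed T) A.

Definition estar_theta_closure (T : topologicalType) (A : set T) : set T :=
  [set x | forall U : set T, estar_open U -> U x ->
    estar_closure U `&` A !=set0].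

Definition estar_theta_closed (T : topologicalType) (A : set T) : Prop :=
  A = estar_theta_closure A.

Definition estar_theta_open (T : topologicalType) (A : set T) : Prop :=
  estar_theta_closed (~` A).

Definition strongly_estar_irresolute (X Y : topologicalType) (f : X -> Y) :
    Prop :=
  forall (x : X) (V : set Y), estar_open V -> V (f x) ->
    exists U : set X,
      [/\ estar_open U, U x & f @` estar_closure U `<=` V].

Definition closed_map (X Y : topologicalType) (f : X -> Y) : Prop :=
  forall F : set X, closed F -> closed (f @` F).

Definition estar_theta_normal (T : topologicalType) : Prop :=
  forall F1 F2 : set T, closed F1 -> closed F2 -> F1 `&` F2 = set0 ->
    exists U1 U2 : set T,
      [/\ estar_theta_open U1, estar_theta_open U2, U1 `&` U2 = set0,
          F1 `<=` U1 & F2 `<=` U2].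

(* Main.v *)
Require Import Defs.
From mathcomp Require Import all_boot all_classical topology.

Local Open Scope classical_set_scope.

(** Push the two closed sets forward and pull the separation back. Their images under [f] are closed
    because [f] is a closed map and disjoint because [f] is injective, so [Y] separates them by
    disjoint $e^*$-$\theta$-open sets, whose preimages separate the original sets. The crux is
    [estar_theta_open_preimage], proved through the pointwise criterion [estar_theta_openP]. *)

Lemma sub_estar_closure (T : topologicalType) (A : set T) :
  A `<=` estar_closure A.
Proof. exact: sub_smallest. Qed.

(** By complementation: [x] escapes the $\theta$-closure of [~] A[exactly when the $e^*$-closure of
    some $e^*$-open]U[around]x[misses]~[A]. *)
Lemma estar_theta_openP (T : topologicalType) (A : set T) :
  estar_theta_open A <->
  forall x, A x ->
    exists U : set T, [/\ estar_open U, U x & estar_closure U `<=` A].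
Proof.
split=> [oA x Ax|nA].
  apply: contrapT => noU.
  suff : (~` A) x by [].
  rewrite oA => U oU Ux; apply: contrapT => UA; apply: noU.
  exists U; split=> // y Uy; apply: contrapT => nAy.
  by apply: UA; exists y.
(* Any set lies in its $\theta$-closure; only the reverse inclusion uses [nA]. *)
apply/seteqP; split=> [x nAx U _ Ux|x clx Ax].
  by exists x; split=> //; exact: sub_estar_closure.
have [U [oU Ux UA]] := nA x Ax.
by have [y [/UA Ay]] := clx U oU Ux; exact.
Qed.

(** Irresoluteness is applied not to [V] but to an $e^*$-open [W] around [f x] whose $e^*$-closure,
    hence [W] itself, lies in [V]. *)
Lemma estar_theta_open_preimage (X Y : topologicalType) (f : X -> Y)
    (V : set Y) :
  strongly_estar_irresolute f -> estar_theta_open V ->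
  estar_theta_open (f @^-1` V).
Proof.
move=> firr /estar_theta_openP oV; apply/estar_theta_openP => x Vfx.
have [W [oW Wfx WV]] := oV _ Vfx.
have [U [oU Ux UW]] := firr x W oW Wfx.
exists U; split=> // y Uy; apply: WV; apply: sub_estar_closure.
by apply: UW; exists y.
Qed.

Theorem theorem12 (X Y : topologicalType) (f : X -> Y)
    (hY : estar_theta_normal Y) (finj : injective f)
    (firr : strongly_estar_irresolute f) (fclosed : closed_map f) :
  estar_theta_normal X.
Proof.
move=> F1 F2 cF1 cF2 F12.
have fF12 : f @` F1 `&` f @` F2 = set0.
  apply/seteqP; split=> // _ [[x F1x <-] [y F2y /finj yx]].
  suff : (F1 `&` F2) x by rewrite F12.
  by split=> //; rewrite -yx.
have [V1 [V2 [oV1 oV2 V12 FV1 FV2]]] :=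
  hY _ _ (fclosed _ cF1) (fclosed _ cF2) fF12.
exists (f @^-1` V1), (f @^-1` V2); split.
- exact: estar_theta_open_preimage.
- exact: estar_theta_open_preimage.
- by rewrite -preimage_setI V12 preimage_set0.
- by move=> x F1x; apply: FV1; exists x.
- by move=> x F2x; apply: FV2; exists x.
Qed.
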